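(* Fix $\alpha\ge 0$. Suppose that for all $\epsilon, r>0$ there exists a positive integer $N$ such that $$\widetilde{\pi}_n^{(\alpha)}\big(\{\theta\in\Theta_n : D_n^{(\alpha)}(\theta)<\epsilon\}\big)\ \ge\ e^{-nr}\quad\text{for all } n\ge N .$$ Then: (a) $\displaystyle\lim_{n\to\infty}\frac1n\,KLD\big(L_n^{*(\alpha)},L_n^{(\alpha)Bayes}\big)=0$ and $\displaystyle\lim_{n\to\infty}\frac1n\,E_{G^n}\Big[KLD\big(\pi_n^{*(\alpha)}(\cdot),\pi_n^{(\alpha)}(\cdot|\underline X_n)\big)\Big]=0$; (b) $\displaystyle\lim_{n\to\infty}\frac1n\,KLD\big(g^n,m_n^{(\alpha)}\big)=0$, so that $G^n$ and $M_n^{(\alpha)}$ merge in probability, i.e. for all $\epsilon>0$, $\displaystyle\lim_{n\to\infty}P\left(\frac{m_n^{(\alpha)}(\underline X_n)}{g^n(\underline X_n)}>e^{-n\epsilon}\right)=1$.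
   Context: General set-up. For each sample size $n\ge1$, $\underline X_n$ is a random element, defined on an underlying true probability space $(\Omega,\mathcal B_\Omega,P)$, with values in a measurable space $(\chi_n,\mathcal B_n)$. Its law $G^n$ has density $g^n$ with respect to a $\sigma$-finite measure $\lambda^n$ on $\chi_n$ (integrals $d\underline x_n$ are with respect to $\lambda^n$). The model is a family $\{F^n(\cdot|\theta):\theta\in\Theta_n\}$, $\Theta_n\subseteq\mathbb R^p$, with densities $f^n(\cdot|\theta)$ with respect to $\lambda^n$. $\Theta_n$ carries a $\sigma$-field $\mathcal B_{\Theta_n}$ and a prior measure $\pi_n$ with $\pi_n(\Theta_n)\le1$. The $\alpha$-likelihood $q_n^{(\alpha)}(\underline x_n|\theta)$, $\alpha\ge0$, is a $\mathcal B_n\times\mathcal B_{\Theta_n}$-measurable function such that $q_n^{(0)}(\underline x_n|\theta)=\lim_{\alpha\downarrow0}q_n^{(\alpha)}(\underline x_n|\theta)=\log f^n(\underline x_n|\theta)-n$. For $S_n\in\mathcal B_n$, $A_n\in\mathcal B_{\Theta_n}$ put $Q_n^{(\alpha)}(S_n|\theta)=\int_{S_n}\exp(q_n^{(\alpha)}(\underline x_n|\theta))\,d\underline x_n$, $M_n^{(\alpha)}(S_n,A_n)=\int_{A_n}Q_n^{(\alpha)}(S_n|\theta)\,\pi_n(d\theta)$, $m_n^{(\alpha)}(\underline x_n,A_n)=\int_{A_n}\exp(q_n^{(\alpha)}(\underline x_n|\theta))\,\pi_n(d\theta)$. It is assumed throughout that $0<M_n^{(\alpha)}(\chi_n,\Theta_n)<\infty$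 and that $0<Q_n^{(\alpha)}(\chi_n|\theta)<\infty$. The $R^{(\alpha)}$-marginal distribution is $M_n^{(\alpha)}(S_n)=M_n^{(\alpha)}(S_n,\Theta_n)/M_n^{(\alpha)}(\chi_n,\Theta_n)$, with density $m_n^{(\alpha)}(\underline x_n)=m_n^{(\alpha)}(\underline x_n,\Theta_n)/M_n^{(\alpha)}(\chi_n,\Theta_n)$ with respect to $\lambda^n$. The $R^{(\alpha)}$-posterior is $\pi_n^{(\alpha)}(A_n|\underline x_n)=m_n^{(\alpha)}(\underline x_n,A_n)/m_n^{(\alpha)}(\underline x_n,\Theta_n)$ when the denominator is finite and positive (arbitrary otherwise). The $R^{(\alpha)}$-Bayes joint law is $L_n^{(\alpha)Bayes}(d\theta,d\underline x_n)=\pi_n^{(\alpha)}(d\theta|\underline x_n)M_n^{(\alpha)}(d\underline x_n)$. The $\alpha$-modified model density is $\widetilde q_n^{(\alpha)}(\underline x_n|\theta)=\exp(q_n^{(\alpha)}(\underline x_n|\theta))/Q_n^{(\alpha)}(\chi_n|\theta)$ and the $\alpha$-modified prior is $\widetilde\pi_n^{(\alpha)}(d\theta)=Q_n^{(\alpha)}(\chi_n|\theta)\pi_n(d\theta)/M_n^{(\alpha)}(\chi_n,\Theta_n)$. $KLD(f_1,f_2)=\int f_1\log(f_1/f_2)\,d\lambda$ is the Kullback–Leibler divergence between densities (or between the corresponding distributions) with respect to a common $\sigma$-finite dominating measure. $D_n^{(\alpha)}(\theta)=\frac1n KLD(g^n,\widetilde q_n^{(\alpha)}(\cdot|\theta))$.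 Finally $\pi_n^{*(\alpha)}(d\theta)=e^{-nD_n^{(\alpha)}(\theta)}\,\widetilde\pi_n^{(\alpha)}(d\theta)/c_n$ with $c_n=\int e^{-nD_n^{(\alpha)}(\theta)}\,\widetilde\pi_n^{(\alpha)}(d\theta)$, and $L_n^{*(\alpha)}(d\theta,d\underline x_n)=\pi_n^{*(\alpha)}(d\theta)\,G^n(d\underline x_n)$. *)

(* Defs.v *)
From HB Require Import structures.
From mathcomp Require Import all_boot all_order all_algebra.
From mathcomp Require Import all_classical all_reals all_analysis.
From mathcomp Require Import measurable_realfun.

Set Implicit Arguments.
Unset Strict Implicit.
Unset Printing Implicit Defensive.

Import Order.TTheory GRing.Theory Num.Theory.
Import numFieldNormedType.Exports.

Local Open Scope classical_set_scope.
Local Open Scope ring_scope.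
Local Open Scope ereal_scope.

Lemma measurable_expeR (R : realType) : measurable_fun setT (@expeR R).
Proof.
rewrite (_ : @expeR R = fun x => if x == +oo then +oo else
  if x == -oo then 0 else (expR (fine x))%:E); last by apply/funext => -[].
apply: measurable_fun_ifT => //; first exact: measurable_fun_eqe.
apply: measurable_fun_ifT => //; first exact: measurable_fun_eqe.
apply/measurable_EFinP; apply: measurableT_comp => //.
Qed.

Lemma measurable_lne (R : realType) : measurable_fun setT (@lne R).
Proof.
rewrite (_ : @lne R = fun x => if x == +oo then +oo else
  if x <= 0 then -oo else (ln (fine x))%:E); last first.
  by apply/funext => -[r| |]//=; rewrite leNye.
apply: measurable_fun_ifT => //; first exact: measurable_fun_eqe.
apply: measurable_fun_ifT => //; first exact: measurable_fun_lee.
by apply/measurable_EFinP; apply: measurableT_comp.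
Qed.

Lemma ge0_inveE (R : realType) (x : \bar R) : 0 <= x -> x^-1 = expeR (- lne x).
Proof.
move: x => [r| |]//=.
rewrite lee_fin inver le_eqVlt => /predU1P[<-|r0].
  by rewrite eqxx lexx.
by rewrite gt_eqF// leNgt r0/= expRN lnK.
Qed.

Section divergence.
Context d (T : measurableType d) (R : realType).

Definition is_density (lam : {measure set T -> \bar R})
    (mu : set T -> \bar R) (f : T -> \bar R) : Prop :=
  [/\ measurable_fun setT f, (forall x, 0 <= f x) &
      forall A, measurable A -> mu A = \int[lam]_(x in A) f x].

(* The extended-real operations give the usual conventions: since [lne 0 = -oo]
   and [inve 0 = +oo], the integrand is 0 where [f1] vanishes and +oo where
   only [f2] vanishes. *)
Definition KLD (lam : {measure set T -> \bar R}) (f1 f2 : T -> \bar R)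
  : \bar R := \int[lam]_x (f1 x * lne (f1 x / f2 x)).

(* Divergence of two finite measures: the value of [KLD lam f1 f2] for densities
   with respect to a common sigma-finite dominating measure, which always exists
   ([mu + nu] dominates both). By [KLD_lawE] the choice is immaterial. *)
Definition KLD_law (mu nu : set T -> \bar R) : \bar R :=
  xget +oo [set v | exists (lam : {sigma_finite_measure set T -> \bar R})
                           (f1 f2 : T -> \bar R),
    [/\ is_density lam mu f1, is_density lam nu f2 & v = KLD lam f1 f2]].

End divergence.

Section KLD_law_theory.
Context d (T : measurableType d) (R : realType).
Implicit Types lam : {sigma_finite_measure set T -> \bar R}.

Lemma is_density_measure lam (mu : set T -> \bar R) f :
  is_density lam mu f -> mu setT < +oo ->
  exists nu : {finite_measure set T -> \bar R},
    forall A, measurable A -> nu A = mu A.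
Proof.
move=> [mf f0 muf] muoo; pose nu0 (A : set T) := \int[lam]_(x in A) f x.
have nu00 : nu0 set0 = 0 by rewrite /nu0 integral_set0.
have nu0_ge0 A : 0 <= nu0 A by apply: integral_ge0 => x _; exact: f0.
have nu0_sigma : semi_sigma_additive nu0.
  move=> F mF tF mUF; rewrite /nu0 ge0_integral_bigcup//; last first.
    exact: measurable_funTS.
  by apply: is_cvg_ereal_nneg_natsum_cond => n _ _; exact: integral_ge0.
pose H1 := isMeasure.Build _ _ _ nu0 nu00 nu0_ge0 nu0_sigma.
pose nu1 : {measure set T -> \bar R} := HB.pack nu0 H1.
have nufin : fin_num_fun nu1.
  by apply: lty_fin_num_fun; rewrite [nu1 _]/(nu0 _) /nu0 -muf.
pose H2 := Measure_isFinite.Build _ _ _ nu1 nufin.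
pose nu : {finite_measure set T -> \bar R} := HB.pack nu0 H1 H2.
by exists nu => A mA; rewrite [nu _]/(nu0 _) /nu0 muf.
Qed.

Lemma is_density_integrable lam (mu : {finite_measure set T -> \bar R}) f :
  is_density lam mu f -> lam.-integrable setT f.
Proof.
move=> [mf f0 muf]; apply/integrableP; split => //.
under eq_integral do rewrite gee0_abs//.
by rewrite -muf// ltey_eq fin_num_measure.
Qed.

Lemma ge0_integral_density lam (mu : {finite_measure set T -> \bar R}) f h
    (E : set T) :
  is_density lam mu f -> measurable_fun setT h -> (forall x, 0 <= h x) ->
  measurable E ->
  \int[lam]_(x in E) (h x * f x) = \int[mu]_(x in E) h x.
Proof.
move=> df mh h0 mE; have intf := is_density_integrable df.
have [mf f0 muf] := df.
have dom : mu `<< lam.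
  apply/null_content_dominatesP => A mA lamA0.
  by rewrite muf// null_set_integral//; exact: measurable_funTS.
have mRN : measurable_fun setT (Radon_Nikodym_SigmaFinite.f mu lam).
  exact: measurable_int (Radon_Nikodym_SigmaFinite.f_integrable dom).
rewrite -(Radon_Nikodym_SigmaFinite.change_of_variables dom)//; last first.
  exact: measurable_funTS.
apply: ae_eq_integral => //.
- by apply: measurable_funTS; exact: emeasurable_funM.
- by apply: measurable_funTS; exact: emeasurable_funM.
apply: ae_eqe_mul2l; apply: (ae_eq_subset (@subsetT _ E)).
apply: integral_ae_eq => // A _ mA.
by rewrite -muf// -Radon_Nikodym_SigmaFinite.f_integral.
Qed.

Lemma integral_density lam (mu : {finite_measure set T -> \bar R}) f h :
  is_density lam mu f -> measurable_fun setT h ->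
  \int[lam]_x (h x * f x) = \int[mu]_x h x.
Proof.
move=> df mh; have [mf f0 _] := df.
have E (u v : \bar R) : 0 <= v -> maxe (u * v) 0 = maxe u 0 * v.
  move=> v0; have [u0|u0] := leP 0 u.
    by rewrite !max_l// mule_ge0.
  by rewrite !max_r ?mul0e ?mule_le0_ge0// ltW.
rewrite integralE [in RHS]integralE; congr (_ - _).
- rewrite -(ge0_integral_density df)//; last exact: measurable_funepos.
  by apply: eq_integral => x _; rewrite !funeposE E.
- rewrite -(ge0_integral_density df)//; last exact: measurable_funeneg.
  by apply: eq_integral => x _; rewrite !funenegE -mulNe E.
Qed.

Lemma KLD_is_density (mu nu : {finite_measure set T -> \bar R}) :
  exists2 h, measurable_fun setT h & forall lam f1 f2,
    is_density lam mu f1 -> is_density lam nu f2 ->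
    KLD lam f1 f2 = \int[mu]_x h x.
Proof.
pose s0 : {measure set T -> \bar R} := msum (fun n => if n is 0%N then mu : {measure set T -> \bar R} else nu) 2.
have s0E A : s0 A = mu A + nu A by exact: measure_addE.
have s0fin : fin_num_fun s0.
  by move=> A mA; rewrite s0E fin_numD !fin_num_measure.
pose H := Measure_isFinite.Build _ _ _ s0 s0fin.
pose s : {finite_measure set T -> \bar R} := HB.pack (Measure.sort s0) H.
have sE A : s A = mu A + nu A by exact: s0E.
have doms (m : {finite_measure set T -> \bar R}) :
    (forall A, measurable A -> m A <= s A) -> m `<< s.
  move=> ms; apply/null_content_dominatesP => A mA sA0.
  by apply/eqP; rewrite eq_le measure_ge0 -sA0 ms.
have musl : mu `<< s by apply: doms => A mA; rewrite sE leeDl.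
have nusl : nu `<< s by apply: doms => A mA; rewrite sE leeDr.
pose a := Radon_Nikodym_SigmaFinite.f mu s.
pose b := Radon_Nikodym_SigmaFinite.f nu s.
have ma : measurable_fun setT a.
  exact: measurable_int (Radon_Nikodym_SigmaFinite.f_integrable musl).
have mb : measurable_fun setT b.
  exact: measurable_int (Radon_Nikodym_SigmaFinite.f_integrable nusl).
have mdiv (u v : T -> \bar R) : measurable_fun setT u -> measurable_fun setT v ->
    (forall x, 0 <= v x) -> measurable_fun setT (fun x => lne (u x / v x)).
  move=> mu_ mv_ v0; apply: measurableT_comp; first exact: measurable_lne.
  under eq_fun do rewrite ge0_inveE//.
  apply: emeasurable_funM => //.
  apply: measurableT_comp; first exact: measurable_expeR.
  by do 2 (apply: measurableT_comp => //); exact: measurable_lne.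
have b0 x : 0 <= b x by exact: Radon_Nikodym_SigmaFinite.f_ge0.
exists (fun x => lne (a x / b x)); first exact: mdiv.
move=> lam f1 f2 df1 df2.
have [mf1 f10 muf] := df1; have [mf2 f20 nuf] := df2.
rewrite /KLD -(integral_density df1); last exact: mdiv.
have dw : is_density lam s (f1 \+ f2).
  split; [exact: emeasurable_funD|by move=> x; exact: adde_ge0|].
  move=> A mA; rewrite sE muf// nuf// ge0_integralD//; exact: measurable_funTS.
have aeE (m : {finite_measure set T -> \bar R}) (f c : T -> \bar R) :
    is_density lam m f -> is_density s m c ->
    ae_eq lam setT f (fun x => c x * (f1 x + f2 x)).
  move=> df [mc c0 mE]; have [mf f0 mfE] := df.
  apply: integral_ae_eq => //.
  - exact: is_density_integrable df.
  - by apply: emeasurable_funM => //; exact: emeasurable_funD.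
  - by move=> A _ mA; rewrite -mfE// (ge0_integral_density dw)// mE.
have dRN (m : {finite_measure set T -> \bar R}) : m `<< s ->
    is_density s m (Radon_Nikodym_SigmaFinite.f m s).
  move=> dm; split.
  - exact: measurable_int (Radon_Nikodym_SigmaFinite.f_integrable dm).
  - exact: Radon_Nikodym_SigmaFinite.f_ge0.
  - by move=> A mA; exact: Radon_Nikodym_SigmaFinite.f_integral.
have ae1 := aeE _ _ _ df1 (dRN _ musl).
have ae2 := aeE _ _ _ df2 (dRN _ nusl).
have fin1 := integrable_ae measurableT (is_density_integrable df1).
have fin2 := integrable_ae measurableT (is_density_integrable df2).
apply: ae_eq_integral => //.
- by apply: emeasurable_funM => //; exact: mdiv.
- by apply: emeasurable_funM => //; exact: mdiv.
rewrite /ae_eq; near=> x => _; rewrite muleC.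
have [->|f1x] := eqVneq (f1 x) 0; first by rewrite !mule0.
congr (lne _ * _).
have F1 : f1 x \is a fin_num by apply: (near fin1 x).
have F2 : f2 x \is a fin_num by apply: (near fin2 x).
have Ea : f1 x = a x * (f1 x + f2 x) by apply: (near ae1 x).
have Eb : f2 x = b x * (f1 x + f2 x) by apply: (near ae2 x).
have w0 : 0 < f1 x + f2 x.
  by rewrite (@lt_le_trans _ _ (f1 x)) ?leeDl// lt_neqAle eq_sym f1x f10.
have wfin : f1 x + f2 x \is a fin_num by rewrite fin_numD F1 F2.
have afin : a x \is a fin_num by exact: Radon_Nikodym_SigmaFinite.f_fin_num.
have bfin : b x \is a fin_num by exact: Radon_Nikodym_SigmaFinite.f_fin_num.
have a0 : 0 < a x.
  rewrite lt_neqAle eq_sym (Radon_Nikodym_SigmaFinite.f_ge0 musl) andbT.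
  by apply: contra_neq f1x => a0; rewrite Ea a0 mul0e.
move: (f1 x + f2 x) w0 wfin Ea Eb => w w0 wfin -> ->.
have [bx0|bx0] := eqVneq (b x) 0.
  by rewrite bx0 mul0e inve0 !gt0_muley// mule_gt0.
rewrite inveM; last by apply: fin_inveM_def => //; rewrite gt_eqF.
by rewrite muleACA divee ?mule1// gt_eqF.
Unshelve. all: by end_near. Qed.

Lemma KLD_lawE lam (mu nu : set T -> \bar R) f1 f2 :
  mu setT < +oo -> nu setT < +oo ->
  is_density lam mu f1 -> is_density lam nu f2 ->
  KLD_law mu nu = KLD lam f1 f2.
Proof.
move=> muoo nuoo df1 df2.
have [mu' mu'E] := is_density_measure df1 muoo.
have [nu' nu'E] := is_density_measure df2 nuoo.
have dE (m : {finite_measure set T -> \bar R}) (m0 : set T -> \bar R) :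
    (forall A, measurable A -> m A = m0 A) ->
    forall l f, is_density l m0 f -> is_density l m f.
  by move=> mE l f [mf f0 E]; split => // A mA; rewrite mE// E.
have [h _ hE] := KLD_is_density mu' nu'.
pose V := [set v | exists (l : {sigma_finite_measure set T -> \bar R})
    (h1 h2 : T -> \bar R),
  [/\ is_density l mu h1, is_density l nu h2 & v = KLD l h1 h2]].
have VK : V (KLD lam f1 f2) by exists lam, f1, f2.
have [l [h1 [h2 [dh1 dh2 VE]]]] : V (KLD_law mu nu) by exact: xgetI VK.
rewrite VE (hE l) ?(hE lam)//; by [exact: dE mu'E _ _ _|exact: dE nu'E _ _ _].
Qed.

End KLD_law_theory.

(* One fixed sample size [n] and one fixed [alpha]. [U] is the sample space,
   [T] the parameter space, and [q] is the alpha-likelihood at that [alpha]. *)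
Section pseudo_bayes.
Context d d' (T : measurableType d) (U : measurableType d') (R : realType).
Variables (lam : {measure set U -> \bar R}) (pi : {measure set T -> \bar R}).
Variable q : U -> T -> \bar R.

Definition Q_mass (S : set U) (t : T) : \bar R :=
  \int[lam]_(x in S) expeR (q x t).

Definition M_mass (S : set U) (A : set T) : \bar R :=
  \int[pi]_(t in A) Q_mass S t.

Definition m_mass (x : U) (A : set T) : \bar R :=
  \int[pi]_(t in A) expeR (q x t).

Definition marginal (S : set U) : \bar R := M_mass S setT / M_mass setT setT.

Definition marginal_density (x : U) : \bar R :=
  m_mass x setT / M_mass setT setT.

Definition is_posterior (post : R.-pker U ~> T) : Prop :=
  forall x, 0 < m_mass x setT -> m_mass x setT < +oo ->
    forall A, measurable A -> post x A = m_mass x A / m_mass x setT.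

(* [post (dtheta | x) marginal (dx)], with the marginal law written through its
   density, see [marginal_densityP]. *)
Definition joint_bayes (post : R.-pker U ~> T) (C : set (T * U)) : \bar R :=
  \int[lam]_x (post x (ysection C x) * marginal_density x).

Definition mod_density (x : U) (t : T) : \bar R :=
  expeR (q x t) / Q_mass setT t.

Definition mod_prior_density (t : T) : \bar R :=
  Q_mass setT t / M_mass setT setT.

Definition mod_prior (A : set T) : \bar R :=
  \int[pi]_(t in A) mod_prior_density t.

Variables (n : nat) (g : U -> R).

Definition D_div (t : T) : \bar R :=
  (n%:R^-1)%:E * KLD lam (EFin \o g) (mod_density ^~ t).

Definition star_weight (t : T) : \bar R := expeR (- (n%:R%:E * D_div t)).

Definition star_const : \bar R :=
  \int[pi]_t (star_weight t * mod_prior_density t).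

Definition star_prior (A : set T) : \bar R :=
  \int[pi]_(t in A) (star_weight t * mod_prior_density t / star_const).

Definition joint_star (G : {measure set U -> \bar R}) (C : set (T * U))
  : \bar R := \int[G]_x star_prior (ysection C x).

End pseudo_bayes.

Lemma marginal_densityP d d' (T : measurableType d) (U : measurableType d')
    (R : realType) (lam : {sigma_finite_measure set U -> \bar R})
    (pi : {sigma_finite_measure set T -> \bar R}) (q : U -> T -> \bar R) :
  measurable_fun setT (fun z : U * T => q z.1 z.2) ->
  is_density lam (marginal lam pi q) (marginal_density lam pi q).
Proof.
move=> mq.
pose h (z : U * T) := expeR (q z.1 z.2).
have mh : measurable_fun setT h.
  by apply: measurableT_comp => //; exact: measurable_expeR.
have h0 z : 0 <= h z by exact: expeR_ge0.
have mm : measurable_fun setT (m_mass pi q ^~ setT).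
  exact: (measurable_fun_fubini_tonelli_F (m2 := pi) h).
have m0 x : 0 <= m_mass pi q x setT.
  by apply: integral_ge0 => t _; exact: expeR_ge0.
have M0 : 0 <= (M_mass lam pi q setT setT)^-1.
  rewrite inve_ge0; apply: integral_ge0 => t _.
  by apply: integral_ge0 => x _; exact: expeR_ge0.
split.
- exact: emeasurable_funM.
- by move=> x; rewrite mule_ge0.
- move=> A mA; rewrite /marginal /marginal_density ge0_integralZr//; last first.
    exact: measurable_funTS.
  congr (_ * _); rewrite /M_mass /m_mass integral_mkcond.
  pose hA := (h \_ (A `*` setT)).
  have mhA : measurable_fun setT hA.
    by apply/(measurable_restrictT _ _).1 => //; [exact: measurableX|
       exact: measurable_funTS].
  have hA0 z : 0 <= hA z by apply: erestrict_ge0.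
  transitivity (\int[lam]_x \int[pi]_t hA (x, t)).
    rewrite (fubini_tonelli hA)// patch_setT; apply: eq_integral => t _.
    rewrite /Q_mass integral_mkcond; apply: eq_integral => x _.
    by rewrite /hA !patchE in_setX/= (mem_set (Logic.I : setT t)) andbT.
  rewrite [RHS]integral_mkcond; apply: eq_integral => x _.
  rewrite patchE; case: ifPn => xA.
    by apply: eq_integral => t _; rewrite /hA patchE in_setX/= xA/= in_setT.
  by rewrite integral0_eq// => t _; rewrite /hA patchE in_setX/= (negbTE xA).
Qed.

(* Values in [-oo, +oo[: -oo accommodates [log 0] at [alpha = 0]. *)
Record alpha_likelihood d d' (T : measurableType d) (U : measurableType d')
    (R : realType) (n : nat) (f : T -> U -> R) (q : R -> U -> T -> \bar R)
  : Prop := AlphaLikelihood {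
  alpha_likelihood_measurable : forall a, (0 <= a)%R ->
    measurable_fun setT (fun z : U * T => q a z.1 z.2) ;
  alpha_likelihood_lty : forall a x t, (0 <= a)%R -> q a x t < +oo ;
  alpha_likelihood_cvg : forall x t, q a x t @[a --> 0%R^'+] --> q 0%R x t ;
  alpha_likelihood0 : forall x t, q 0%R x t = lne (f t x)%:E - n%:R%:E }.

(* Main.v *)
(* For a fixed sample size, write s for the density of the star prior, w for that
   of the modified prior, r_t for the modified model density, m for the marginal
   density and c for the normalizing constant. Integrating
   s(t) g(x) log (s(t) g(x) / (w(t) r_t(x))) over x first, the weight
   exp (- n D(t)) in s(t) = exp (- n D(t)) w(t) / c cancels KLD(g, r_t) = n D(t),
   and the joint divergence is exactly - log c. Integrating over t first, it is
   KLD(g, m) plus the G-expectation of the divergence to the posterior, so both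
   of these nonnegative terms are at most - log c. The prior mass condition gives
   c >= exp (- n eps) exp (- n r), hence - log c = o(n).

   Both orders of integration are handled by Tonelli's theorem after replacing
   a log (a / b) by the nonnegative a log (a / b) - a + b. *)
Require Import Defs.
From HB Require Import structures.
From mathcomp Require Import all_boot all_order all_algebra.
From mathcomp Require Import all_classical all_reals all_analysis.
From mathcomp Require Import measurable_realfun ring lra.

Set Implicit Arguments.
Unset Strict Implicit.
Unset Printing Implicit Defensive.

Import Order.TTheory GRing.Theory Num.Theory.
Import numFieldNormedType.Exports.

Local Open Scope classical_set_scope.
Local Open Scope ring_scope.
Local Open Scope ereal_scope.

(** * Integral comparison and additivity for extended-real functions *)

Section integral_ae.
Context d (T : measurableType d) (R : realType).
Variable mu : {measure set T -> \bar R}.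
Import HBNNSimple.

(* Unlike [ae_ge0_le_integral] and [ae_eq_integral], these comparisons assume no
   measurability: [\int] is a supremum over simple functions, and these can be
   truncated to 0 on a null set. *)
Lemma ge0_le_integral_ae (f h : T -> \bar R) :
  (forall x, 0 <= f x) -> (forall x, 0 <= h x) ->
  {ae mu, forall x, f x <= h x} -> \int[mu]_x f x <= \int[mu]_x h x.
Proof.
move=> f0 h0 [N [mN muN fhN]].
rewrite !ge0_integralTE//; apply: ge_ereal_sup => _ [phi /= phif <-].
pose psi := mul_nnsfun phi (indic_nnsfun R (measurableC mN)).
have psiE x : psi x = (phi x * \1_(~` N) x)%R by [].
rewrite (_ : sintegral mu phi = sintegral mu psi); last first.
  rewrite -!integralT_nnsfun; apply: ae_eq_integral => //.
  - by apply/measurable_EFinP.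
  - by apply/measurable_EFinP.
  exists N; split => // x /= /not_implyP[_]; apply: contra_notP => Nx.
  by rewrite [mindic _ _ _]indicE mem_set ?mulr1.
apply: ereal_sup_ubound; exists psi => // x; rewrite [psi x]psiE indicE.
have [Nx|Nx] := boolP (x \in ~` N); last by rewrite mulr0.
rewrite mulr1 (le_trans (phif x))//.
by move: Nx; rewrite inE; apply: contra_notP => /negP nfh; apply: fhN => /=; exact/negP.
Qed.

Lemma le_integral_ae (f h : T -> \bar R) :
  {ae mu, forall x, f x <= h x} -> \int[mu]_x f x <= \int[mu]_x h x.
Proof.
move=> fh; rewrite integralE [leRHS]integralE.
have max_le (u v w : \bar R) : u <= v -> maxe u w <= maxe v w.
  by move=> uv; rewrite ge_max !le_max uv lexx orbT.
apply: leeB; apply: ge0_le_integral_ae => //; apply: filterS fh => x fh.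
  by rewrite !funeposE max_le.
by rewrite !funenegE max_le// leeN2.
Qed.

Lemma eq_integral_ae (f h : T -> \bar R) :
  {ae mu, forall x, f x = h x} -> \int[mu]_x f x = \int[mu]_x h x.
Proof.
by move=> fh; apply/le_anti/andP; split; apply: le_integral_ae;
  apply: filterS fh => x ->.
Qed.

(** Only the case where [u] has infinite integral goes beyond integrable additivity. The negative
    part of the sum is then at most the absolute value of [v], so its integral is finite, while the
    positive part plus that absolute value dominates [u], so the integral of the positive part is
    infinite. *)
Lemma ge0_integralD_EFin (u : T -> \bar R) (v : T -> R) :
  measurable_fun setT u -> (forall x, 0 <= u x) ->
  mu.-integrable setT (EFin \o v) ->
  \int[mu]_x (u x + (v x)%:E) = \int[mu]_x u x + \int[mu]_x (v x)%:E.
Proof.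
move=> mu_ u0 iv; have mv := measurable_int _ iv.
have iabs : \int[mu]_x `|(v x)%:E| < +oo by have /integrableP[] := iv.
have vfin : \int[mu]_x (v x)%:E \is a fin_num by exact: integrable_fin_num.
have [iu|] := ltP (\int[mu]_x u x) +oo.
  rewrite integralD//; apply/integrableP; split => //.
  by under eq_integral do rewrite gee0_abs//.
rewrite leye_eq => /eqP iuy; rewrite iuy addye; last first.
  by move: vfin; rewrite fin_numE => /andP[].
have mw : measurable_fun setT (fun x => u x + (v x)%:E) by exact: emeasurable_funD.
have mva : measurable_fun setT (fun x => `|(v x)%:E|) by exact: measurableT_comp.
rewrite integralE.
have wneg : \int[mu]_x (fun x => u x + (v x)%:E)^\- x < +oo.
  apply: le_lt_trans iabs; apply: le_integral_ae; apply: aeW => x.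
  rewrite funenegE ge_max abse_ge0 andbT.
  apply: le_trans (_ : - (v x)%:E <= _).
    by rewrite leeN2 leeDr.
  by rewrite -abseN lee_abs.
have wpos : \int[mu]_x (fun x => u x + (v x)%:E)^\+ x = +oo.
  apply/eqP; rewrite -leye_eq -iuy.
  have : \int[mu]_x u x <= \int[mu]_x ((fun x => u x + (v x)%:E)^\+ x + `|(v x)%:E|).
    apply: le_integral_ae; apply: aeW => x.
    apply: (@le_trans _ _ (u x + (v x)%:E + `|(v x)%:E|)).
      rewrite -addeA leeDl// -EFinD lee_fin addrC -lerBlDr sub0r.
      by rewrite -normrN ler_norm.
    by rewrite leeD2r// funeposE le_max lexx.
  rewrite ge0_integralD//; last exact: measurable_funepos.
  rewrite iuy; move: iabs; case: (\int[mu]_x `|(v x)%:E|) => [r| |]//=;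
    by case: (\int[mu]_x _) => [s| |]//=.
rewrite wpos addye//; move: wneg; rewrite lt_neqAle => /andP[wneg _].
by rewrite eqe_oppLR.
Qed.

End integral_ae.

(** * The nonnegative divergence integrand on reals *)

Section kldiv.
Context (R : realType).
Implicit Types a b u v : R.

(* The integrand of [KLD], shifted by [b - a] so as to be nonnegative: this
   leaves the integral unchanged for probability densities and makes Tonelli's
   theorem applicable. *)
Definition kldiv a b : \bar R :=
  if a == 0%R then b%:E else
  if b == 0%R then +oo else (a * (ln a - ln b) + (b - a))%:E.

(** The case split in [kldiv] mirrors the conventions of [KLD]: for [a = 0] the left side vanishes
    and the shift cancels [b]; for [b = 0 < a] both sides are [+oo]. *)
Lemma mule_lne_kldiv a b : (0 <= a)%R -> (0 <= b)%R ->
  a%:E * lne (a%:E / b%:E) = kldiv a b + (a - b)%:E.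
Proof.
rewrite /kldiv; have [->|a0 +] := eqVneq a 0%R.
  by move=> _ _; rewrite mul0e sub0r -EFinD subrr.
rewrite le_eqVlt eq_sym (negbTE a0)/= => {}a0.
have [->|b0 +] := eqVneq b 0%R.
  by rewrite inve0 gt0_muley ?lte_fin//= gt0_muley ?lte_fin.
rewrite le_eqVlt eq_sym (negbTE b0)/= => {}b0.
rewrite inver gt_eqF// -EFinM lne_EFin ?divr_gt0// -EFinM -EFinD.
by rewrite ln_div ?posrE//; congr (_%:E); ring.
Qed.

(** The inequality [ln y <= y - 1] at [y = b / a], multiplied by [a]. *)
Lemma kldiv_ge0 a b : (0 <= a)%R -> (0 <= b)%R -> 0 <= kldiv a b.
Proof.
rewrite /kldiv; have [->//|a0 +] := eqVneq a 0%R.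
rewrite le_eqVlt eq_sym (negbTE a0)/= => {}a0.
have [//|b0 +] := eqVneq b 0%R.
rewrite le_eqVlt eq_sym (negbTE b0)/= => {}b0.
rewrite lee_fin -ln_div ?posrE// -invf_div lnV ?posrE ?divr_gt0// mulrN addrC subr_ge0.
have ab : (a * (b / a) = b)%R by rewrite mulrCA divff ?mulr1// gt_eqF.
have : (ln (1 + (b / a - 1)) <= b / a - 1)%R.
  by apply: le_ln1Dx; rewrite ltrBrDl subrr divr_gt0.
by rewrite addrC subrK -(ler_pM2l a0 (ln _)) mulrBr ab mulr1.
Qed.

(** Pointwise chain rule. The correction is real and linear in [u] and [v], hence integrable for
    densities even where [kldiv u v] is infinite. *)
Lemma kldivM a b u v : (0 < a)%R -> (0 < b)%R -> (0 <= u)%R -> (0 <= v)%R ->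
  kldiv (a * u) (b * v) =
  a%:E * kldiv u v + (a * (ln a - ln b) * u + (b - a) * v)%:E.
Proof.
move=> a0 b0 u0 v0; rewrite /kldiv !mulf_eq0 (gt_eqF a0) (gt_eqF b0)/=.
have [->|u1] := eqVneq u 0%R.
  by rewrite mulr0 add0r -EFinM -EFinD mulrBl addrC subrK.
have [->|v1] := eqVneq v 0%R; first by rewrite gt0_muley ?lte_fin.
have {}u0 : (0 < u)%R by rewrite lt_neqAle eq_sym u1.
have {}v0 : (0 < v)%R by rewrite lt_neqAle eq_sym v1.
rewrite -EFinM -EFinD; congr (_%:E).
by rewrite !lnM ?posrE//; ring.
Qed.

Lemma measurable_fun_invr_ge0 d (T : measurableType d) (f : T -> R) :
  (forall x, 0 <= f x)%R -> measurable_fun setT f ->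
  measurable_fun setT (fun x => (f x)^-1%R).
Proof.
move=> f0 mf; under eq_fun do rewrite -powR_inv1//.
exact: (measurableT_comp (measurable_powR _)).
Qed.

Lemma measurable_kldiv d (T : measurableType d) (f h : T -> R) :
  measurable_fun setT f -> measurable_fun setT h ->
  measurable_fun setT (fun x => kldiv (f x) (h x)).
Proof.
move=> mf mh; apply: measurable_fun_ifT.
- exact: measurable_fun_eqr.
- exact/measurable_EFinP.
apply: measurable_fun_ifT => //; first exact: measurable_fun_eqr.
apply/measurable_EFinP; apply: measurable_funD; last exact: measurable_funB.
by apply: measurable_funM => //; apply: measurable_funB; exact: measurableT_comp.
Qed.

End kldiv.

(** * Probability densities and their divergence *)

Section pdensity.
Context d (T : measurableType d) (R : realType).
Variable mu : {measure set T -> \bar R}.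

Definition pdensity (f : T -> R) : Prop :=
  [/\ measurable_fun setT f, (forall x, (0 <= f x)%R) &
      \int[mu]_x (f x)%:E = 1].

Lemma pdensity_integrable f : pdensity f -> mu.-integrable setT (EFin \o f).
Proof.
move=> [mf f0 f1]; apply/integrableP; split; first exact/measurable_EFinP.
by under eq_integral do rewrite /= ger0_norm//; rewrite f1 ltry.
Qed.

Lemma integral_pdensityD f1 f2 (a b : R) : pdensity f1 -> pdensity f2 ->
  mu.-integrable setT (fun x => (a * f1 x + b * f2 x)%:E) /\
  \int[mu]_x (a * f1 x + b * f2 x)%:E = (a + b)%:E.
Proof.
move=> pf1 pf2; have [_ _ f11] := pf1; have [_ _ f21] := pf2.
have i1 := integrableZl measurableT a (pdensity_integrable pf1).
have i2 := integrableZl measurableT b (pdensity_integrable pf2).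
split; first by have := integrableD measurableT i1 i2; apply: eq_integrable.
under eq_integral do rewrite EFinD !EFinM.
rewrite integralD// !integralZl//; do ?exact: pdensity_integrable.
by rewrite f11 f21 !mule1 EFinD.
Qed.

(** The two integrands differ by [f1 - f2], which integrates to 0 because both masses are 1. *)
Lemma KLD_kldiv f1 f2 : pdensity f1 -> pdensity f2 ->
  KLD mu (EFin \o f1) (EFin \o f2) = \int[mu]_x kldiv (f1 x) (f2 x).
Proof.
move=> pf1 pf2; have [mf1 f10 _] := pf1; have [mf2 f20 _] := pf2.
have [i iE] := integral_pdensityD 1 (- 1) pf1 pf2.
rewrite /KLD; under eq_integral do rewrite /= mule_lne_kldiv//.
have E x : (1 * f1 x + - 1 * f2 x)%R = (f1 x - f2 x)%R by rewrite mul1r mulN1r.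
rewrite ge0_integralD_EFin//.
- by under [X in _ + X]eq_integral do rewrite -E; rewrite iE subrr adde0.
- exact: measurable_kldiv.
- by move=> x; exact: kldiv_ge0.
- by apply: eq_integrable i => // x _; rewrite E.
Qed.

Lemma KLD_ge0 f1 f2 : pdensity f1 -> pdensity f2 ->
  0 <= KLD mu (EFin \o f1) (EFin \o f2).
Proof.
move=> pf1 pf2; rewrite KLD_kldiv//; apply: integral_ge0 => x _.
by case: pf1 pf2 => [_ f10 _] [_ f20 _]; exact: kldiv_ge0.
Qed.

(** Chain rule for a factored density: with unit masses, the linear correction of [kldivM]
    integrates to exactly [kldiv a b]. It serves both orders of integration of the joint
    divergence. *)
Lemma integral_kldivM f1 f2 (a b : R) : (0 < a)%R -> (0 < b)%R ->
  pdensity f1 -> pdensity f2 ->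
  \int[mu]_x kldiv (a * f1 x) (b * f2 x) =
  a%:E * KLD mu (EFin \o f1) (EFin \o f2) + kldiv a b.
Proof.
move=> a0 b0 pf1 pf2; have [mf1 f10 _] := pf1; have [mf2 f20 _] := pf2.
have [i iE] := integral_pdensityD (a * (ln a - ln b)) (b - a) pf1 pf2.
under eq_integral do rewrite kldivM//.
have mk := measurable_kldiv mf1 mf2.
rewrite ge0_integralD_EFin//.
- rewrite iE ge0_integralZl//; last 2 first.
    by move=> x _; exact: kldiv_ge0.
    by rewrite lee_fin ltW.
  by rewrite -KLD_kldiv// /kldiv !gt_eqF.
- exact: measurable_funeM.
- by move=> x; rewrite mule_ge0 ?kldiv_ge0// lee_fin ltW.
Qed.

End pdensity.

(** * Almost-everywhere statements under a law with a density *)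

Section density_ae.
Context d (T : measurableType d) (R : realType).
Variables (lam mu : {measure set T -> \bar R}) (g : T -> R).
Hypothesis g_density : is_density lam mu (EFin \o g).

Lemma density_ae (A : T -> Prop) :
  {ae lam, forall x, A x} -> {ae mu, forall x, A x}.
Proof.
move=> [N [mN lamN0 AN]]; exists N; split => //.
have [mg _ ->] := g_density => //.
by rewrite null_set_integral//; exact: measurable_funTS.
Qed.

Lemma density_gt0_ae : {ae mu, forall x, (0 < g x)%R}.
Proof.
have [mg g0 gE] := g_density.
have mA : measurable [set x | (EFin \o g) x = 0].
  by rewrite -[X in measurable X]setTI; exact: mg (emeasurable_set1 0).
exists [set x | (EFin \o g) x = 0]; split => //.
  by rewrite gE// integral0_eq.
move=> x /= /negP; rewrite -leNgt => gx0; congr (_%:E).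
by apply/le_anti; rewrite gx0 -lee_fin g0.
Qed.

End density_ae.

(** * Sigma-finiteness of the product measure *)

Section product_sigma_finite.
Context d1 d2 (T1 : measurableType d1) (T2 : measurableType d2) (R : realType).
Variables (m1 : {sigma_finite_measure set T1 -> \bar R})
  (m2 : {sigma_finite_measure set T2 -> \bar R}).

(* Type inference finds a sigma-finite structure on [m1 \x m2] only for
   subprobabilities [m1] and [m2]. *)
Lemma sigma_finite_product_measure1 :
  exists J : {sigma_finite_measure set (T1 * T2)%type -> \bar R},
    J = (m1 \x m2 : {measure set (T1 * T2)%type -> \bar R}) :> {measure set _ -> \bar R}.
Proof.
have sfin : sigma_finite setT (m1 \x m2).
  have /sigma_finiteP[F [FT ndF Foo]] := sigma_finiteT m1.
  have /sigma_finiteP[H [HT ndH Hoo]] := sigma_finiteT m2.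
  exists (fun n => F n `*` H n) => [|k].
    apply/esym/seteqP; split => // -[x y] _.
    have [i _ Fx] : (\bigcup_i F i) x by rewrite -FT.
    have [j _ Hy] : (\bigcup_i H i) y by rewrite -HT.
    exists (maxn i j) => //; split => /=.
      by move: x Fx; apply/subsetPset/ndF/leq_maxl.
    by move: y Hy; apply/subsetPset/ndH/leq_maxr.
  have [mFk Fk] := Foo k; have [mHk Hk] := Hoo k.
  split; first exact: measurableX.
  by rewrite product_measure1E// lte_mul_pinfty// ge0_fin_numE.
pose P : {measure set (T1 * T2)%type -> \bar R} := m1 \x m2.
pose S := Measure_isSigmaFinite.Build _ _ _ P sfin.
pose J : {sigma_finite_measure set (T1 * T2)%type -> \bar R} :=
  HB.pack (Measure.sort P) S.
by exists J.
Qed.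

End product_sigma_finite.

(** * Bounds at one fixed sample size: densities and their measurability *)

Section one_sample.
Context d d' (T : measurableType d) (U : measurableType d') (R : realType).
Variables (lam : {sigma_finite_measure set U -> \bar R})
  (pi : {sigma_finite_measure set T -> \bar R}) (q : U -> T -> \bar R)
  (n : nat) (g : U -> R) (G : probability U R).
Hypothesis n_gt0 : (0 < n)%N.
Hypothesis mq : measurable_fun setT (fun z : U * T => q z.1 z.2).
Hypothesis q_lty : forall x t, q x t < +oo.
Hypothesis g_density : is_density lam G (EFin \o g).
Hypothesis M_gt0_lty : 0 < M_mass lam pi q setT setT < +oo.
Hypothesis Q_gt0_lty : forall t, 0 < Q_mass lam q setT t < +oo.

(** Real versions of the exponentiated likelihood, its masses, the modified prior density [w] and
    the modified model density [r], as required by [kldiv]. The hypotheses make the underlying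
    values finite, so [fine] loses nothing. [K] is n times [D_div]. *)
Let e (x : U) (t : T) : R := fine (expeR (q x t)).
Let Q (t : T) : R := fine (Q_mass lam q setT t).
Let M : R := fine (M_mass lam pi q setT setT).
Let w (t : T) : R := (Q t / M)%R.
Let r (t : T) (x : U) : R := (e x t / Q t)%R.
Let K (t : T) : \bar R := KLD lam (EFin \o g) (EFin \o r t).

Let fin_gt0E (y : \bar R) : 0 < y < +oo -> y = (fine y)%:E /\ (0 < fine y)%R.
Proof.
by move=> y0; rewrite fine_gt0// fineK// gt0_fin_numE; case/andP: y0.
Qed.

Let eE x t : expeR (q x t) = (e x t)%:E.
Proof.
by rewrite fineK// ge0_fin_numE ?expeR_ge0// ltey expeR_eqy -ltey.
Qed.

Let e_ge0 x t : (0 <= e x t)%R.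
Proof. by rewrite fine_ge0// expeR_ge0. Qed.

Let QE t : Q_mass lam q setT t = (Q t)%:E.
Proof. by have [] := fin_gt0E (Q_gt0_lty t). Qed.

Let Q_gt0 t : (0 < Q t)%R.
Proof. by have [] := fin_gt0E (Q_gt0_lty t). Qed.

Let ME : M_mass lam pi q setT setT = M%:E.
Proof. by have [] := fin_gt0E M_gt0_lty. Qed.

Let M_gt0 : (0 < M)%R.
Proof. by have [] := fin_gt0E M_gt0_lty. Qed.

Let w_gt0 t : (0 < w t)%R.
Proof. exact: divr_gt0. Qed.

Let r_ge0 t x : (0 <= r t x)%R.
Proof. by rewrite divr_ge0// ltW. Qed.

Let eMw x t : (e x t / M = w t * r t x)%R.
Proof. by rewrite /w /r [RHS]mulrC mulrA divfK ?gt_eqF. Qed.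

Let mexp : measurable_fun setT (fun z : U * T => expeR (q z.1 z.2)).
Proof. by apply: measurableT_comp => //; exact: measurable_expeR. Qed.

Let me : measurable_fun setT (fun z : U * T => e z.1 z.2).
Proof. exact: measurableT_comp. Qed.

Let mes : measurable_fun setT (fun z : T * U => e z.2 z.1).
Proof. exact: (measurableT_comp me (@measurable_swap _ _ T U)). Qed.

Let mQe : measurable_fun setT (Q_mass lam q setT).
Proof.
apply: (measurable_fun_fubini_tonelli_G (m1 := lam)
  (fun z : U * T => expeR (q z.1 z.2))) => // z.
exact: expeR_ge0.
Qed.

Let mQ : measurable_fun setT Q.
Proof. exact: measurableT_comp. Qed.

Let mw : measurable_fun setT w.
Proof. by apply: measurable_funM. Qed.

Let mrs : measurable_fun setT (fun z : T * U => r z.1 z.2).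
Proof.
apply: measurable_funM => //; apply: measurable_fun_invr_ge0 => [z|].
  exact: ltW.
exact: measurableT_comp.
Qed.

Let mr t : measurable_fun setT (r t).
Proof. exact: (measurableT_comp mrs (pair1_measurable t)). Qed.

Let mg : measurable_fun setT g.
Proof. by case: g_density => /measurable_EFinP. Qed.

Let g_ge0 x : (0 <= g x)%R.
Proof. by case: g_density => _ /(_ x) + _; rewrite lee_fin. Qed.

Let pg : pdensity lam g.
Proof.
by case: g_density => _ _ gE; split => //; rewrite -gE// probability_setT.
Qed.

Let pr t : pdensity lam (r t).
Proof.
split => //; under eq_integral do rewrite EFinM -eE.
rewrite ge0_integralZr//; last 3 first.
- under eq_fun do rewrite eE; apply/measurable_EFinP.
  exact: (measurableT_comp mes (pair1_measurable t)).
- by move=> x _; exact: expeR_ge0.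
- by rewrite lee_fin invr_ge0 ltW.
by rewrite [X in X * _]QE -EFinM divff// gt_eqF.
Qed.

Let pw : pdensity pi w.
Proof.
split => //; first by move=> t; exact: ltW.
under eq_integral do rewrite EFinM -QE.
rewrite ge0_integralZr//; last 2 first.
- by move=> t _; rewrite QE lee_fin ltW.
- by rewrite lee_fin invr_ge0 ltW.
by rewrite [X in X * _]ME -EFinM divff// gt_eqF.
Qed.

Let mod_densityE x t : mod_density lam q x t = (r t x)%:E.
Proof. by rewrite /mod_density eE QE inver gt_eqF. Qed.

Let mod_prior_densityE t : mod_prior_density lam pi q t = (w t)%:E.
Proof. by rewrite /mod_prior_density ME QE inver gt_eqF. Qed.

Let nDE t : n%:R%:E * D_div lam q n g t = K t.
Proof.
rewrite /D_div muleA -EFinM divff ?mul1e ?pnatr_eq0 -?lt0n// /K.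
by congr KLD; apply/funext => x /=; exact: mod_densityE.
Qed.

Let K_ge0 t : 0 <= K t.
Proof. exact: KLD_ge0 pg (pr t). Qed.

Let mK : measurable_fun setT K.
Proof.
rewrite (_ : K = fun t => \int[lam]_x kldiv (g x) (r t x)).
  apply: (measurable_fun_fubini_tonelli_F (m2 := lam)
    (fun z : T * U => kldiv (g z.2) (r z.1 z.2))) => [|z].
    by apply: measurable_kldiv => //; exact: measurableT_comp.
  exact: kldiv_ge0.
by apply/funext => t; rewrite /K (KLD_kldiv pg (pr t)).
Qed.

(** Vanishes exactly where [K] is infinite, so such parameters get no mass from the star prior. *)
Let wt (t : T) : R := fine (expeR (- K t)).

Let wtE t : star_weight lam q n g t = (wt t)%:E.
Proof.
rewrite /star_weight nDE /wt fineK// ge0_fin_numE ?expeR_ge0//.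
by rewrite ltey expeR_eqy -ltey (@le_lt_trans _ _ 0) ?oppe_le0.
Qed.

Let wt_ge0 t : (0 <= wt t)%R.
Proof. by rewrite fine_ge0 ?expeR_ge0. Qed.

Let wt_le1 t : (wt t <= 1)%R.
Proof.
have := K_ge0 t; rewrite /wt; case: (K t) => [k| |]//=; rewrite lee_fin => k0.
by rewrite -expR0 ler_expR oppr_le0.
Qed.

Let mwt : measurable_fun setT wt.
Proof.
apply: measurableT_comp => //; apply: measurableT_comp => //.
  exact: measurable_expeR.
exact: measurableT_comp.
Qed.

Let mD : measurable_fun setT (D_div lam q n g).
Proof.
rewrite (_ : D_div _ _ _ _ = fun t => n%:R^-1%:E * K t).
  exact: measurable_funeM.
apply/funext => t; rewrite -nDE muleA -EFinM mulVf ?mul1e//.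
by rewrite pnatr_eq0 -lt0n.
Qed.

(** * The normalizing constant and the star prior density *)

(** On the set where [D_div] is below [eps] the weight is at least exp(-n eps); off that set it is
    bounded below by 0. *)
Lemma star_const_ge (eps : R) :
  (expR (- (n%:R * eps)))%:E *
    mod_prior lam pi q [set t | D_div lam q n g t < eps%:E] <=
  star_const lam pi q n g.
Proof.
set A := [set t | _].
have mA : measurable A.
  by rewrite -[A]setTI; exact: emeasurable_fun_infty_o.
rewrite /mod_prior -ge0_integralZl//; last 2 first.
- by rewrite (funext mod_prior_densityE); apply: measurable_funTS; apply/measurable_EFinP.
- by move=> t _; rewrite mod_prior_densityE lee_fin ltW.
rewrite integral_mkcond; apply: le_integral_ae; apply: aeW => t.
rewrite patchE; case: ifPn => [|_]; last first.
  by rewrite mule_ge0// ?wtE ?mod_prior_densityE lee_fin// ltW.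
rewrite inE /A/= => Dt; rewrite lee_wpmul2r//.
  by rewrite mod_prior_densityE lee_fin ltW.
rewrite /star_weight -[_%:E]/(expeR (- (n%:R * eps)%R%:E)) lee_expeR.
by rewrite leeN2 EFinM lee_wpmul2l ?lee_fin ?ler0n// ltW.
Qed.

Hypothesis star_const_gt0 : 0 < star_const lam pi q n g.
Let c : R := fine (star_const lam pi q n g).

(** The weights are at most 1 because [K] is nonnegative, and [w] has mass 1. *)
Lemma star_const_le1 : star_const lam pi q n g <= 1.
Proof.
case: pw => _ _ <-; apply: le_integral_ae; apply: aeW => t.
by rewrite wtE mod_prior_densityE -EFinM lee_fin ler_piMl// ltW.
Qed.

Let cE : star_const lam pi q n g = c%:E.
Proof.
by have [] // := @fin_gt0E (star_const lam pi q n g);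
  rewrite star_const_gt0 (le_lt_trans star_const_le1) ?ltry.
Qed.

Let c_gt0 : (0 < c)%R.
Proof. by rewrite -lte_fin -cE. Qed.

Let s (t : T) : R := (wt t * w t / c)%R.

Let sE t : star_weight lam q n g t * mod_prior_density lam pi q t /
  star_const lam pi q n g = (s t)%:E.
Proof. by rewrite wtE mod_prior_densityE cE inver gt_eqF. Qed.

Let ms : measurable_fun setT s.
Proof. by apply: measurable_funM => //; exact: measurable_funM. Qed.

Let s_ge0 t : (0 <= s t)%R.
Proof. by apply: divr_ge0; [apply: mulr_ge0 => //; exact: ltW|exact: ltW]. Qed.

Let ps : pdensity pi s.
Proof.
split => //; under eq_integral do rewrite EFinM EFinM.
rewrite ge0_integralZr//; last 3 first.
- by apply/measurable_EFinP; exact: measurable_funM.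
- by move=> t _; rewrite -EFinM lee_fin mulr_ge0// ltW.
- by rewrite lee_fin invr_ge0 ltW.
rewrite (_ : \int[pi]_x _ = c%:E) -?EFinM ?divff// ?gt_eqF//.
by rewrite -cE; apply: eq_integral => t _; rewrite wtE mod_prior_densityE.
Qed.

(** * The joint divergence, integrating over the sample first *)

(** The chain rule gives [s t * K t] plus [kldiv (s t) (w t)]. Since ln s = - K + ln w - ln c, the
    terms in [K] cancel. *)
Let integral_kldiv_sample t : \int[lam]_x kldiv (s t * g x) (e x t / M) =
  (- ln c * s t + (w t - s t))%:E.
Proof.
under eq_integral do rewrite eMw.
(* Here the integrand reduces to [w t * r t x], of integral [w t]; [K t] may be infinite. *)
have [s0|s_neq0] := eqVneq (s t) 0%R.
  rewrite s0 mulr0 add0r subr0.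
  under eq_integral do rewrite mul0r /kldiv eqxx EFinM.
  have [mrt _ r1] := pr t.
  rewrite ge0_integralZl ?r1 ?mule1 ?lee_fin ?ltW//.
    exact/measurable_EFinP.
  by move=> x _; rewrite lee_fin.
have s_gt0 : (0 < s t)%R by rewrite lt0r s_neq0 s_ge0.
rewrite (integral_kldivM s_gt0 (w_gt0 t) pg (pr t)) -/(K t) /kldiv !gt_eqF//.
have : s t = (wt t * w t / c)%R by [].
(* An infinite [K t] would force [s t = 0], already excluded. *)
have := K_ge0 t; rewrite /wt; case: (K t) => [k| |]//= _; last first.
  by move=> s0; move: s_gt0; rewrite s0 !mul0r ltxx.
move=> st; have -> : (ln (s t) = - k + ln (w t) - ln c)%R.
  have ew_gt0 : (0 < expR (- k) * w t)%R by rewrite mulr_gt0 ?expR_gt0.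
  by rewrite st ln_div ?posrE// lnM ?posrE ?expR_gt0// expRK.
by rewrite -EFinM -EFinD; congr (_%:E); ring.
Qed.

Let mgs : measurable_fun setT (fun z : T * U => g z.2).
Proof. exact: measurableT_comp. Qed.

Let msg : measurable_fun setT (fun z : T * U => (s z.1 * g z.2)%R).
Proof. by apply: measurable_funM => //; exact: measurableT_comp. Qed.

Let meM : measurable_fun setT (fun z : T * U => (e z.2 z.1 / M)%R).
Proof. exact: measurable_funM. Qed.

Let sg_ge0 t x : (0 <= s t * g x)%R.
Proof. exact: mulr_ge0. Qed.

Let eM_ge0 x t : (0 <= e x t / M)%R.
Proof. by rewrite eMw; apply: mulr_ge0 => //; exact: ltW. Qed.

(** Shifted integrand of the joint divergence: the density of [joint_star] against that of
    [joint_bayes]. *)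
Let F (z : T * U) := kldiv (s z.1 * g z.2) (e z.2 z.1 / M).

Let mF : measurable_fun setT F.
Proof. exact: measurable_kldiv. Qed.

Let F_ge0 z : 0 <= F z.
Proof. exact: kldiv_ge0. Qed.

Let integral_F : \int[pi]_t \int[lam]_x F (t, x) = (- ln c)%:E.
Proof.
transitivity (\int[pi]_t ((- ln c - 1) * s t + 1 * w t)%:E).
  by apply: eq_integral => t _; rewrite integral_kldiv_sample; congr (_%:E); ring.
by have [_ ->] := integral_pdensityD (- ln c - 1) 1 ps pw; rewrite subrK.
Qed.

Let psg : pdensity (pi \x lam) (fun z => (s z.1 * g z.2)%R).
Proof.
split => [|z|]; [exact: msg|exact: sg_ge0|].
rewrite (fubini_tonelli1 (fun z => (s z.1 * g z.2)%:E)); last 2 first.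
- exact/measurable_EFinP.
- by move=> z; rewrite lee_fin.
have [_ _ <-] := ps; apply: eq_integral => t _; rewrite /fubini_F/=.
under eq_integral do rewrite EFinM.
rewrite ge0_integralZl ?lee_fin//; last 2 first.
- exact/measurable_EFinP.
- by move=> x _; rewrite lee_fin.
by have [_ _ ->] := pg; rewrite mule1.
Qed.

Let peM : pdensity (pi \x lam) (fun z => (e z.2 z.1 / M)%R).
Proof.
split => [|z|]; [exact: meM|exact: eM_ge0|].
rewrite (fubini_tonelli1 (fun z => (e z.2 z.1 / M)%:E)); last 2 first.
- exact/measurable_EFinP.
- by move=> z; rewrite lee_fin.
have [_ _ <-] := pw; apply: eq_integral => t _; rewrite /fubini_F/=.
under eq_integral do rewrite eMw EFinM.
have [mrt _ r1] := pr t.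
rewrite ge0_integralZl ?r1 ?mule1 ?lee_fin ?ltW//.
  exact/measurable_EFinP.
by move=> x _; rewrite lee_fin.
Qed.

(** * The joint divergence, integrating over the parameter first *)

Let m (x : U) : \bar R := m_mass pi q x setT.

Let mm : measurable_fun setT m.
Proof.
apply: (measurable_fun_fubini_tonelli_F (m2 := pi)
  (fun z : U * T => expeR (q z.1 z.2))) => // z.
exact: expeR_ge0.
Qed.

Let m_ge0 x : 0 <= m x.
Proof. by apply: integral_ge0 => t _; exact: expeR_ge0. Qed.

Let mE x : m x = \int[pi]_t (e x t)%:E.
Proof. by apply: eq_integral => t _; rewrite eE. Qed.

Let integral_m : \int[lam]_x m x = M%:E.
Proof.
rewrite -ME; apply: (fubini_tonelli (fun z : U * T => expeR (q z.1 z.2))) => // z.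
exact: expeR_ge0.
Qed.

Let ge0_integral_lty_ae (h : U -> \bar R) : measurable_fun setT h ->
  (forall x, 0 <= h x) -> \int[lam]_x h x < +oo -> {ae lam, forall x, h x < +oo}.
Proof.
move=> mh h0 hoo; have ih : lam.-integrable setT h.
  by apply/integrableP; split => //; under eq_integral do rewrite gee0_abs//.
apply: filterS (integrable_ae measurableT ih) => x /(_ Logic.I).
by rewrite ge0_fin_numE.
Qed.

Let Phi (x : U) := \int[pi]_t F (t, x).

Let integral_Phi : \int[lam]_x Phi x = (- ln c)%:E.
Proof. by rewrite -integral_F (fubini_tonelli F). Qed.

Let m_lty : {ae lam, forall x, m x < +oo}.
Proof. by apply: ge0_integral_lty_ae => //; rewrite integral_m ltry. Qed.

Let Phi_lty : {ae lam, forall x, Phi x < +oo}.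
Proof.
apply: ge0_integral_lty_ae; last by rewrite integral_Phi ltry.
  exact: (measurable_fun_fubini_tonelli_G (m1 := pi) F).
by move=> x; exact: integral_ge0.
Qed.

Let mes1 x : measurable_fun setT (e x).
Proof. exact: (measurableT_comp me (pair1_measurable x)). Qed.

(** If [m x] were 0, then [e x] would vanish almost everywhere and [F] would be infinite wherever
    [s] is positive. Finiteness of [Phi x] would then force [s = 0] almost everywhere, against its
    unit mass. *)
Let m_gt0 x : (0 < g x)%R -> Phi x < +oo -> 0 < m x.
Proof.
move=> gx0 Phix; rewrite lt0e m_ge0 andbT; apply/eqP => mx0.
have mFx : measurable_fun setT (fun t => F (t, x)).
  exact: (measurableT_comp mF (pair2_measurable x)).
have e0 : {ae pi, forall t, e x t = 0%R}.
  have mex : measurable_fun setT (fun t => (e x t)%:E) by exact/measurable_EFinP.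
  have /(ae_eq_integral_abs pi measurableT mex) : \int[pi]_t `|(e x t)%:E| = 0.
    by rewrite -[RHS]mx0 mE; apply: eq_integral => t _; rewrite gee0_abs ?lee_fin.
  by apply: filterS => t /(_ Logic.I) [].
have F_fin : {ae pi, forall t, F (t, x) < +oo}.
  have ih : pi.-integrable setT (fun t => F (t, x)).
    by apply/integrableP; split => //; under eq_integral do rewrite gee0_abs//.
  apply: filterS (integrable_ae measurableT ih) => t /(_ Logic.I).
  by rewrite ge0_fin_numE.
have : \int[pi]_t (s t)%:E = \int[pi]_t 0.
  apply: eq_integral_ae; apply: filterS2 e0 F_fin => t.
  rewrite /F/= => ->; rewrite /kldiv mul0r eqxx mulf_eq0 (gt_eqF gx0) orbF.
  by case: eqP => [->//|]; rewrite ltxx.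
by have [_ _ ->] := ps; rewrite integral0 => /eqP; rewrite eqe oner_eq0.
Qed.

(** [mbar] is the marginal density and [b x] the posterior density with respect to [pi]. All three
    take the default value 0 where [m x] is infinite, which is a null set. *)
Let mf (x : U) : R := fine (m x).
Let mbar (x : U) : R := (mf x / M)%R.
Let b (x : U) (t : T) : R := (e x t / mf x)%R.


Let mfE x : m x < +oo -> m x = (mf x)%:E.
Proof. by move=> moo; rewrite /mf fineK// ge0_fin_numE. Qed.

Let mf_ge0 x : (0 <= mf x)%R.
Proof. by rewrite fine_ge0. Qed.

Let mf_gt0 x : 0 < m x -> m x < +oo -> (0 < mf x)%R.
Proof. by move=> m0 moo; rewrite -lte_fin -mfE. Qed.

Let mmf : measurable_fun setT mf.
Proof. exact: measurableT_comp. Qed.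

Let marginal_densityE x : m x < +oo ->
  marginal_density lam pi q x = (mbar x)%:E.
Proof.
by move=> moo; rewrite /marginal_density ME -/(m x) mfE// inver gt_eqF.
Qed.

Let pmbar : pdensity lam mbar.
Proof.
split => [|x|]; [exact: measurable_funM|by apply: divr_ge0 => //; exact: ltW|].
transitivity (\int[lam]_x (m x * M^-1%:E)).
  by apply: eq_integral_ae; apply: filterS m_lty => x moo; rewrite mfE// -EFinM.
rewrite ge0_integralZr ?integral_m -?EFinM ?divff ?gt_eqF//.
by rewrite lee_fin invr_ge0 ltW.
Qed.

Let pb x : 0 < m x -> m x < +oo -> pdensity pi (b x).
Proof.
move=> m0 moo; have mfx := mf_gt0 m0 moo.
split => [|t|]; [exact: measurable_funM|exact: divr_ge0|].
under eq_integral do rewrite EFinM.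
rewrite ge0_integralZr//; last 3 first.
- exact/measurable_EFinP.
- by move=> t _; rewrite lee_fin.
- by rewrite lee_fin invr_ge0.
by rewrite -mE mfE// -EFinM divff// gt_eqF.
Qed.

(** For [g x > 0], the chain rule applies to [g x * s t] against [mbar x * b x t], with [m_gt0]
    making [b x] a density. For [g x = 0], the integrand is [e x t / M], which integrates to
    [mbar x]. *)
Let PhiE x : m x < +oo -> Phi x < +oo ->
  Phi x = (g x)%:E * KLD pi (EFin \o s) (EFin \o b x) + kldiv (g x) (mbar x).
Proof.
move=> moo Phioo; have [gx0|gx_neq0] := eqVneq (g x) 0%R.
  rewrite /Phi /F/= gx0 mul0e add0e /kldiv eqxx.
  under eq_integral do rewrite mulr0 eqxx EFinM.
  rewrite ge0_integralZr//; last 3 first.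
  - exact/measurable_EFinP.
  - by move=> t _; rewrite lee_fin.
  - by rewrite lee_fin invr_ge0 ltW.
  by rewrite -mE mfE// -EFinM.
have gx : (0 < g x)%R by rewrite lt0r gx_neq0 g_ge0.
have m0 := m_gt0 gx Phioo; have mfx := mf_gt0 m0 moo.
have mbx : (0 < mbar x)%R by exact: divr_gt0.
rewrite -(integral_kldivM gx mbx ps (pb m0 moo)).
apply: eq_integral => t _; rewrite /F /mbar /b/= mulrC; congr kldiv.
by rewrite [RHS]mulrC mulrA divfK ?gt_eqF.
Qed.

Let kldiv_g_mbar_ge0 x : 0 <= kldiv (g x) (mbar x).
Proof. by have [_ mb0 _] := pmbar; exact: kldiv_ge0. Qed.

Let KLD_marginalE : KLD lam (EFin \o g) (marginal_density lam pi q) =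
  \int[lam]_x kldiv (g x) (mbar x).
Proof.
rewrite -(KLD_kldiv pg pmbar); apply: eq_integral_ae; apply: filterS m_lty => x moo.
by rewrite marginal_densityE.
Qed.

(** Discards the nonnegative posterior term of [PhiE] and integrates over the sample. *)
Lemma KLD_marginal_le : KLD lam (EFin \o g) (marginal_density lam pi q) <=
  (- ln (fine (star_const lam pi q n g)))%:E.
Proof.
rewrite KLD_marginalE -/c -integral_Phi; apply: le_integral_ae.
apply: filterS2 m_lty Phi_lty => x moo Phioo; rewrite PhiE// leeDr//.
have [gx0|gx_neq0] := eqVneq (g x) 0%R; first by rewrite gx0 mul0e.
have gx : (0 < g x)%R by rewrite lt0r gx_neq0 g_ge0.
apply: mule_ge0; first by rewrite lee_fin.
exact: KLD_ge0 ps (pb (m_gt0 gx Phioo) moo).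
Qed.

Lemma KLD_marginal_ge0 : 0 <= KLD lam (EFin \o g) (marginal_density lam pi q).
Proof. by rewrite KLD_marginalE; apply: integral_ge0 => x _. Qed.

Let star_priorE A : star_prior lam pi q n g A = \int[pi]_(t in A) (s t)%:E.
Proof. by apply: eq_integral => t _; rewrite sE. Qed.

(** * Divergence from the star prior to the posterior *)

Variable post : R.-pker U ~> T.
Hypothesis post_posterior : is_posterior pi q post.

Let KLD_posteriorE x : 0 < m x -> m x < +oo ->
  KLD_law (star_prior lam pi q n g) (post x) = \int[pi]_t kldiv (s t) (b x t).
Proof.
move=> m0 moo; have [mbx b0 _] := pb m0 moo; have [mbs s0 s1] := ps.
rewrite -(KLD_kldiv ps (pb m0 moo)).
apply: (@KLD_lawE _ _ _ pi).
- by rewrite star_priorE s1 ltry.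
- by rewrite prob_kernel ltry.
- split; [exact/measurable_EFinP|by move=> t; rewrite lee_fin|].
  by move=> A mA; rewrite star_priorE.
- split; [exact/measurable_EFinP|by move=> t; rewrite lee_fin|].
  move=> A mA; rewrite post_posterior// -/(m x) mfE// inver gt_eqF ?mf_gt0//.
  rewrite /m_mass -ge0_integralZr ?lee_fin ?invr_ge0//.
  + by apply: eq_integral => t _; rewrite eE -EFinM.
  + apply: measurable_funTS; rewrite (funext (eE x)).
    exact/measurable_EFinP.
  + by move=> t _; exact: expeR_ge0.
Qed.

Lemma integral_KLD_posterior_le :
  \int[G]_x KLD_law (star_prior lam pi q n g) (post x) <=
  (- ln (fine (star_const lam pi q n g)))%:E.
Proof.
pose k (z : T * U) := kldiv (s z.1) (b z.2 z.1).
pose B x := \int[pi]_t k (t, x).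
have mk : measurable_fun setT k.
  apply: measurable_kldiv; first exact: measurableT_comp.
  apply: measurable_funM => //; apply: measurable_fun_invr_ge0 => //.
  exact: measurableT_comp.
have k0 z : 0 <= k z by apply: kldiv_ge0 => //; exact: divr_ge0.
have mB : measurable_fun setT B.
  exact: (measurable_fun_fubini_tonelli_G (m1 := pi) k).
have B0 x : 0 <= B x by exact: integral_ge0.
(* Almost surely under [G], [g x] is positive and [m x] is positive and finite, so Bayes' formula
   determines [post x]. Tonelli makes [B] measurable, which allows the change from [G] to [lam]. *)
rewrite (_ : \int[G]_x _ = \int[G]_x B x); last first.
  apply: eq_integral_ae.
  apply: filterS3 (density_gt0_ae g_density) (density_ae g_density m_lty)
    (density_ae g_density Phi_lty) => x gx moo Phioo.
  by rewrite KLD_posteriorE//; exact: m_gt0.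
rewrite -(ge0_integral_density g_density)// -/c -integral_Phi.
apply: le_integral_ae; apply: filterS2 m_lty Phi_lty => x moo Phioo.
rewrite PhiE// muleC.
have [gx0|gx_neq0] := eqVneq (g x) 0%R.
  by rewrite /= gx0 !mul0e add0e -gx0.
have gx : (0 < g x)%R by rewrite lt0r gx_neq0 g_ge0.
have m0 := m_gt0 gx Phioo.
by rewrite (KLD_kldiv ps (pb m0 moo)) leeDl.
Qed.


(** * Densities of the two joint laws and their exact divergence *)

Let joint_star_density :
  is_density (pi \x lam) (joint_star lam pi q n g G)
    (fun z => (s z.1 * g z.2)%:E).
Proof.
split; [exact/measurable_EFinP|by move=> z; rewrite lee_fin|move=> A mA].
pose h := (fun z : T * U => (s z.1)%:E) \_ A.
have mh : measurable_fun setT h.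
  apply/(measurable_restrictT _ _).1 => //; apply: measurable_funTS.
  by apply/measurable_EFinP; exact: measurableT_comp.
have h0 z : 0 <= h z by apply: erestrict_ge0 => y _; rewrite lee_fin.
have mhg : measurable_fun setT (fun z => h z * (g z.2)%:E).
  by apply: emeasurable_funM => //; exact/measurable_EFinP.
rewrite integral_mkcond (_ : _ \_ _ = fun z => h z * (g z.2)%:E); last first.
  by apply/funext => z; rewrite /h !patchE; case: ifPn => _; rewrite ?mul0e// EFinM.
rewrite (fubini_tonelli2 (fun z => h z * (g z.2)%:E))//; last first.
  by move=> z; rewrite mule_ge0// lee_fin.
transitivity (\int[G]_x \int[pi]_t h (t, x)).
  apply: eq_integral => x _; rewrite star_priorE integral_mkcond.
  by apply: eq_integral => t _; rewrite /h !patchE mem_ysection.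
rewrite -(ge0_integral_density g_density)//; last 2 first.
- exact: (measurable_fun_fubini_tonelli_G (m1 := pi) h).
- by move=> x; exact: integral_ge0.
apply: eq_integral => x _; rewrite /fubini_G/= ge0_integralZr ?lee_fin//.
exact: (measurableT_comp mh (pair2_measurable x)).
Qed.

(** For [m x] positive and finite, the factor [m x] cancels between posterior and marginal. Where
    [m x = 0] the arbitrary posterior is multiplied by 0, and [m x] is infinite only on a null
    set. *)
Let joint_bayes_density :
  is_density (pi \x lam) (joint_bayes lam pi q post)
    (fun z => (e z.2 z.1 / M)%:E).
Proof.
split; [exact/measurable_EFinP|by move=> z; rewrite lee_fin|move=> A mA].
pose h := (fun z : T * U => (e z.2 z.1 / M)%:E) \_ A.
have mh : measurable_fun setT h.
  by apply/(measurable_restrictT _ _).1 => //; apply/measurable_funTS/measurable_EFinP.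
have h0 z : 0 <= h z by apply: erestrict_ge0 => y _; rewrite lee_fin.
rewrite integral_mkcond (fubini_tonelli2 h)//.
apply: eq_integral_ae; apply: filterS m_lty => x moo.
have mAx : measurable (ysection A x) by exact: measurable_ysection.
have M1 : 0 <= M^-1%:E :> \bar R by rewrite lee_fin invr_ge0 ltW.
have mex : measurable_fun setT (fun t => (e x t)%:E) by exact/measurable_EFinP.
rewrite /fubini_G (_ : \int[pi]_y h (y, x) = m_mass pi q x (ysection A x) * M^-1%:E).
  have [m0|] := ltP 0 (m x).
    rewrite post_posterior// marginal_densityE// -/(m x) mfE//.
    rewrite inver gt_eqF ?mf_gt0// -muleA; congr (_ * _).
    by rewrite -EFinM /mbar mulrA mulVf ?mul1r// gt_eqF// mf_gt0.
  move=> mx0; have {}mx0 : m x = 0 by apply/le_anti; rewrite mx0 m_ge0.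
  rewrite /marginal_density -/(m x) mx0 mul0e mule0.
  rewrite (_ : m_mass _ _ _ _ = 0) ?mul0e//; apply/le_anti/andP; split.
    rewrite -mx0; apply: ge0_subset_integral => //.
    - by rewrite (funext (eE x)).
    - by move=> t _; exact: expeR_ge0.
  by apply: integral_ge0 => t _; exact: expeR_ge0.
rewrite /m_mass -ge0_integralZr//; last 2 first.
- by apply: measurable_funTS; rewrite (funext (eE x)).
- by move=> t _; exact: expeR_ge0.
rewrite [RHS]integral_mkcond; apply: eq_integral => t _.
by rewrite /h !patchE mem_ysection eE -EFinM.
Qed.

Lemma KLD_joint : KLD_law (joint_star lam pi q n g G) (joint_bayes lam pi q post) =
  (- ln (fine (star_const lam pi q n g)))%:E.
Proof.
have [_ _ sg1] := psg; have [_ _ eM1] := peM.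
have [_ _ jsE] := joint_star_density; have [_ _ jbE] := joint_bayes_density.
have [J JE] := sigma_finite_product_measure1 pi lam.
have dS := joint_star_density; have dB := joint_bayes_density.
rewrite -JE in dS dB.
rewrite (KLD_lawE _ _ dS dB) ?jsE ?jbE ?sg1 ?eM1 ?ltry//.
rewrite JE (KLD_kldiv psg peM) -integral_F.
exact: (fubini_tonelli1 F).
Qed.

Lemma integral_KLD_posterior_ge0 :
  0 <= \int[G]_x KLD_law (star_prior lam pi q n g) (post x).
Proof.
rewrite -(@integral0 _ _ _ G setT); apply: le_integral_ae.
apply: filterS3 (density_gt0_ae g_density) (density_ae g_density m_lty)
  (density_ae g_density Phi_lty) => x gx moo Phioo.
rewrite KLD_posteriorE//; last exact: m_gt0.
by apply: integral_ge0 => t _; apply: kldiv_ge0 => //; exact: divr_ge0.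
Qed.

(** * A Markov-type bound for the density ratio *)

(** Where the ratio is at most exp(-k), g (ln g - ln mbar) >= k g, so [kldiv (g x) (mbar x)] is at
    least [(k - 1) * g x]; the loss of 1 is the shift in [kldiv]. Nonnegativity of [kldiv] elsewhere
    turns this into a bound on probability. *)
Lemma marginal_density_ratio_prob (k : R) : (1 < k)%R ->
  measurable [set x | (expR (- k))%:E < marginal_density lam pi q x / (g x)%:E] /\
  (k - 1)%:E *
    G (~` [set x | (expR (- k))%:E < marginal_density lam pi q x / (g x)%:E]) <=
  (- ln (fine (star_const lam pi q n g)))%:E.
Proof.
move=> k1; set A := [set x | _].
have mA : measurable A.
  rewrite -[A]setTI; apply: emeasurable_fun_o_infty => //.
  apply: emeasurable_funM; first exact: emeasurable_funM.
  under eq_fun do rewrite ge0_inveE ?lee_fin//.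
  apply: measurableT_comp; first exact: measurable_expeR.
  apply: measurableT_comp => //.
  by apply: measurableT_comp; [exact: measurable_lne|exact/measurable_EFinP].
split => //; have mCA := measurableC mA; have [_ _ ->] := g_density => //.
apply: le_trans KLD_marginal_le; rewrite KLD_marginalE.
rewrite -ge0_integralZl//; last 3 first.
- by apply/measurable_funTS/measurable_EFinP.
- by move=> x _; rewrite lee_fin.
- by rewrite lee_fin subr_ge0 ltW.
rewrite integral_mkcond; apply: le_integral_ae; apply: filterS m_lty => x moo.
rewrite patchE; case: ifPn => [|_]; last exact: kldiv_g_mbar_ge0.
rewrite inE /A/= => /negP; rewrite -leNgt marginal_densityE//.
have [_ mbar_ge0 _] := pmbar.
have [gx0|gx_neq0] := eqVneq (g x) 0%R.
  by rewrite gx0 mule0 /kldiv eqxx lee_fin.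
have gx : (0 < g x)%R by rewrite lt0r gx_neq0 g_ge0.
rewrite inver gt_eqF// -!EFinM lee_fin ler_pdivrMr// /kldiv (negbTE gx_neq0).
have [_ _|mb_neq0 gmb] := eqVneq (mbar x) 0%R; first by rewrite leey.
have mb : (0 < mbar x)%R by rewrite lt0r mb_neq0 mbar_ge0.
have : (ln (mbar x) <= - k + ln (g x))%R.
  by rewrite -[leRHS]expRK expRD lnK ?posrE// ler_ln ?posrE// mulr_gt0 ?expR_gt0.
rewrite -lerBlDr -lerNr opprB lee_fin => /(ler_wpM2l (ltW gx)).
by rewrite mulrBl mul1r (mulrC k); lra.
Qed.

End one_sample.

(** * Passage to the limit in the sample size *)

Lemma cvge0_rate (R : realType) (V : nat -> \bar R) :
  (forall delta : R, (0 < delta)%R ->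
    \forall n \near \oo, 0 <= V n <= (n%:R * delta)%:E) ->
  (n%:R^-1)%:E * V n @[n --> \oo] --> 0.
Proof.
move=> Vrate; have rate (delta : R) : (0 < delta)%R -> \forall n \near \oo,
    0 <= (n%:R^-1)%:E * V n <= delta%:E.
  move=> delta0; near=> n.
  have n0 : (0 < n%:R :> R)%R by rewrite ltr0n; near: n; exact: nbhs_infty_gt.
  have /andP[V0 Vle] : 0 <= V n <= (n%:R * delta)%:E.
    by near: n; exact: Vrate.
  have n1 : 0 <= n%:R^-1%:E :> \bar R by rewrite lee_fin invr_ge0 ltW.
  rewrite mule_ge0//=.
  have -> : delta = (n%:R^-1 * (n%:R * delta))%R by rewrite mulKf// gt_eqF.
  by rewrite EFinM lee_wpmul2l.
apply/fine_cvgP; split.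
  apply: filterS (rate 1%R ltr01) => n /andP[V0 V1].
  by rewrite ge0_fin_numE// (le_lt_trans V1) ?ltry.
apply/cvgr0Pnorm_le => delta delta0; apply: filterS (rate _ delta0) => n /andP[V0 V1].
rewrite /= ger0_norm ?fine_ge0// -lee_fin fineK//.
by rewrite ge0_fin_numE// (le_lt_trans V1) ?ltry.
Unshelve. all: by end_near. Qed.

Theorem theorem3p1 (R : realType)
  (* the true probability space *)
  (dO : measure_display) (Omega : measurableType dO) (P : probability Omega R)
  (* the sample spaces, their dominating measures, and the observations *)
  (dU : nat -> measure_display) (chi : forall n, measurableType (dU n))
  (lam : forall n, {sigma_finite_measure set (chi n) -> \bar R})
  (X : forall n, {mfun Omega >-> chi n})
  (g : forall n, chi n -> R)
  (* the parameter spaces, identified with subsets of R^p through iota *)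
  (p : nat) (dT : nat -> measure_display)
  (Theta : forall n, measurableType (dT n))
  (iota : forall n, Theta n -> 'rV[R]_p)
  (pi : forall n, subprobability (Theta n) R)
  (* the model and the alpha-likelihood *)
  (F : forall n, Theta n -> probability (chi n) R)
  (f : forall n, Theta n -> chi n -> R)
  (q : forall n, R -> chi n -> Theta n -> \bar R)
  (alpha : R)
  (post : forall n, R.-pker (chi n) ~> (Theta n)) :
  (0 <= alpha)%R ->
  (forall n, (0 < n)%N -> injective (iota n)) ->
  (forall n, (0 < n)%N ->
    is_density (lam n) (distribution P (X n)) (EFin \o g n)) ->
  (forall n (t : Theta n), (0 < n)%N ->
    is_density (lam n) (F n t) (EFin \o f n t)) ->
  (forall n, (0 < n)%N -> alpha_likelihood n (f n) (q n)) ->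
  (forall n, (0 < n)%N ->
    0 < M_mass (lam n) (pi n) (q n alpha) setT setT < +oo) ->
  (forall n (t : Theta n), (0 < n)%N ->
    0 < Q_mass (lam n) (q n alpha) setT t < +oo) ->
  (forall n, (0 < n)%N -> is_posterior (pi n) (q n alpha) (post n)) ->
  (forall eps r : R, (0 < eps)%R -> (0 < r)%R ->
    exists2 N : nat, (0 < N)%N & forall n, (N <= n)%N ->
      (expR (- (n%:R * r)))%:E <=
      mod_prior (lam n) (pi n) (q n alpha)
        [set t | D_div (lam n) (q n alpha) n (g n) t < eps%:E]) ->
  [/\ (n%:R^-1)%:E *
        KLD_law (joint_star (lam n) (pi n) (q n alpha) n (g n)
                   (distribution P (X n)))
                (joint_bayes (lam n) (pi n) (q n alpha) (post n))
        @[n --> \oo] --> 0,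
      (n%:R^-1)%:E *
        \int[distribution P (X n)]_x
          KLD_law (star_prior (lam n) (pi n) (q n alpha) n (g n)) (post n x)
        @[n --> \oo] --> 0,
      (n%:R^-1)%:E *
        KLD (lam n) (EFin \o g n)
          (marginal_density (lam n) (pi n) (q n alpha))
        @[n --> \oo] --> 0 &
      forall eps : R, (0 < eps)%R ->
        P [set w | (expR (- (n%:R * eps)))%:E <
                   marginal_density (lam n) (pi n) (q n alpha) (X n w) /
                   (g n (X n w))%:E]
        @[n --> \oo] --> 1 ].
Proof.
move=> alpha0 _ g_density _ q_lik M_fin Q_fin post_pi prior_mass.
pose c n := star_const (lam n) (pi n) (q n alpha) n (g n).
have mq n (n0 : (0 < n)%N) := alpha_likelihood_measurable (q_lik n n0) alpha0.
have q_lty n (n0 : (0 < n)%N) x t := alpha_likelihood_lty (q_lik n n0) x t alpha0.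
have rate (delta : R) : (0 < delta)%R -> \forall n \near \oo,
    [/\ (0 < n)%N, 0 < c n & (- ln (fine (c n)) <= n%:R * delta)%R].
  (* Half of [delta] is spent on the weight exp(-n eps), the other half on the prior mass exp(-n
     r). *)
  move=> delta0; have d20 : (0 < delta / 2)%R by rewrite divr_gt0.
  have [N N0 HN] := prior_mass _ _ d20 d20.
  exists N => // n /= Nn; have n0 := leq_trans N0 Nn.
  have cge : (expR (- (n%:R * delta)))%:E <= c n.
    apply: le_trans (star_const_ge n0 (mq n n0) (q_lty n n0) (g_density n n0)
      (M_fin n n0) (fun t => Q_fin n t n0) (delta / 2)).
    have -> : (- (n%:R * delta) = - (n%:R * (delta / 2)) + - (n%:R * (delta / 2)))%R.
      by rewrite -opprD -mulrDr -splitr.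
    by rewrite expRD EFinM lee_wpmul2l ?lee_fin ?expR_ge0//; exact: HN.
  have c0 : 0 < c n by rewrite (lt_le_trans _ cge)// lte_fin expR_gt0.
  split => //.
  have coo : c n \is a fin_num.
    rewrite gt0_fin_numE// (le_lt_trans _ (ltry 1))//.
    exact: star_const_le1 n0 (mq n n0) (q_lty n n0) (g_density n n0)
      (M_fin n n0) (fun t => Q_fin n t n0).
  have fc0 : (0 < fine (c n))%R by rewrite -lte_fin fineK.
  rewrite lerNl -[leLHS]expRK ler_ln ?posrE ?expR_gt0//.
  by rewrite -lee_fin fineK.
have jointE n (n0 : (0 < n)%N) (c0 : 0 < c n) :=
  KLD_joint n0 (mq n n0) (q_lty n n0)
    (g_density n n0) (M_fin n n0) (fun t => Q_fin n t n0) c0 (post_pi n n0).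
have posterior_ge0 n (n0 : (0 < n)%N) (c0 : 0 < c n) :=
  integral_KLD_posterior_ge0 n0 (mq n n0) (q_lty n n0)
    (g_density n n0) (M_fin n n0) (fun t => Q_fin n t n0) c0 (post_pi n n0).
have posterior_le n (n0 : (0 < n)%N) (c0 : 0 < c n) :=
  integral_KLD_posterior_le n0 (mq n n0) (q_lty n n0)
    (g_density n n0) (M_fin n n0) (fun t => Q_fin n t n0) c0 (post_pi n n0).
have marginal_ge0 n (n0 : (0 < n)%N) :=
  KLD_marginal_ge0 (mq n n0) (g_density n n0) (M_fin n n0).
have marginal_le n (n0 : (0 < n)%N) (c0 : 0 < c n) :=
  KLD_marginal_le n0 (mq n n0) (q_lty n n0)
    (g_density n n0) (M_fin n n0) (fun t => Q_fin n t n0) c0.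
have ratio n (n0 : (0 < n)%N) (c0 : 0 < c n) :=
  marginal_density_ratio_prob n0 (mq n n0) (q_lty n n0)
    (g_density n n0) (M_fin n n0) (fun t => Q_fin n t n0) c0.
split.
(* The joint divergence equals - ln c, whose nonnegativity follows by squeezing the marginal
   divergence below it. *)
- apply: cvge0_rate => delta /rate; apply: filterS => n [n0 c0 cle].
  rewrite (jointE n n0 c0); apply/andP; split; last by rewrite lee_fin.
  exact: le_trans (marginal_ge0 n n0) (marginal_le n n0 c0).
- apply: cvge0_rate => delta /rate; apply: filterS => n [n0 c0 cle].
  by rewrite (posterior_ge0 n n0 c0) (le_trans (posterior_le n n0 c0)).
- apply: cvge0_rate => delta /rate; apply: filterS => n [n0 c0 cle].
  by rewrite (marginal_ge0 n n0) (le_trans (marginal_le n n0 c0)).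
- move=> eps eps0; pose A n := [set x : chi n | (expR (- (n%:R * eps)))%:E <
    marginal_density (lam n) (pi n) (q n alpha) x / (g n x)%:E].
  have tail (eta : R) : (0 < eta)%R -> \forall n \near \oo,
      measurable (A n) /\ distribution P (X n) (~` A n) <= eta%:E.
    (* With [k = n * eps], the tail is at most (n eps eta / 2) / (n eps - 1), which is at most [eta]
       once [n * eps] exceeds 2. *)
    move=> eta0; have d0 : (0 < eps * eta / 2)%R by rewrite divr_gt0 ?mulr_gt0.
    near=> n.
    have [n0 c0 cle] : [/\ (0 < n)%N, 0 < c n &
      (- ln (fine (c n)) <= n%:R * (eps * eta / 2))%R] by near: n; exact: rate.
    have n_ge : (2 / eps < n%:R)%R by near: n; exact: nbhs_infty_gtr.
    have k2 : (2 < n%:R * eps)%R by rewrite -ltr_pdivrMr.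
    have k1 : (1 < n%:R * eps)%R by lra.
    have [mA PA] := ratio n n0 c0 _ k1.
    split=> //; have mCA := measurableC mA.
    have Pfin : distribution P (X n) (~` A n) \is a fin_num.
      exact: fin_num_measure.
    have {}PA : (n%:R * eps - 1)%:E * distribution P (X n) (~` A n) <=
        (- ln (fine (c n)))%:E by exact: PA.
    rewrite -(fineK Pfin) -EFinM lee_fin in PA.
    rewrite -(fineK Pfin) lee_fin.
    have k10 : (0 < n%:R * eps - 1)%R by lra.
    rewrite -(ler_pM2l k10); apply: (le_trans PA); apply: (le_trans cle).
    have : (0 < eta * (n%:R * eps - 2))%R by rewrite mulr_gt0// subr_gt0.
    lra.
  have mXA n (B : set (chi n)) : measurable B -> measurable (X n @^-1` B).
    by move=> mB; rewrite -[X in measurable X]setTI; exact: (measurable_funPT (X n)).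
  apply/fine_cvgP; split.
    apply: filterS (tail 1%R ltr01) => n [mA _].
    exact: fin_num_measure (mXA n _ mA).
  apply/cvgrPdist_le => eta /tail; apply: filterS => n [mA PA].
  have mXAn := mXA n _ mA; have mXCAn := measurableC mXAn.
  (* The distance from 1 of the probability of the event is the tail just bounded, pulled back along
     [X n]. *)
  have PC : P (X n @^-1` A n) + P (X n @^-1` (~` A n)) = 1.
    rewrite -[X n @^-1` (~` A n)]/(~` (X n @^-1` A n)) -measureU ?setUv//.
      exact: probability_setT.
    exact: setICr.
  have Pfin (B : set (chi n)) : measurable B -> P (X n @^-1` B) \is a fin_num.
    by move=> mB; exact: fin_num_measure (mXA n _ mB).
  have mCA := measurableC mA.
  rewrite /= -[P [set w | _]]/(P (X n @^-1` A n)).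
  have E : (1 = fine (P (X n @^-1` A n)) + fine (P (X n @^-1` (~` A n))))%R.
    by rewrite -fineD ?Pfin// PC.
  rewrite {1}E addrAC.
  rewrite subrr add0r ger0_norm ?fine_ge0//.
  by rewrite -lee_fin fineK// Pfin.
Unshelve. all: by end_near. Qed.
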